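(* Let $X_1$ and $X_2$ be two fuzzy incidence graphs with effective pairs (i.e. all of whose pairs are effective). Then the Cartesian product $X_1\times X_2$ is a fuzzy incidence graph with effective pairs.
   Context: Fuzzy incidence graphs. All graphs are finite, simple and undirected; $\wedge$ denotes minimum. A fuzzy incidence graph (FIG) $X=(V,E,I,\varepsilon,\rho,\eta)$ consists of a nonempty finite vertex set $V$, a set $E$ of edges $xy=yx$ ($x\neq y$ in $V$), a set $I$ of (incidence) pairs $(x,xy)$ with $xy\in E$ and $x$ an endpoint of $xy$, and functions $\varepsilon:V\to(0,1]$, $\rho:E\to(0,1]$, $\eta:I\to(0,1]$ with $\rho(xy)\le\varepsilon(x)\wedge\varepsilon(y)$ for all $xy\in E$ and $\eta(x,xy)\le\varepsilon(x)\wedge\rho(xy)$ for all $(x,xy)\in I$ (vertices, edges, pairs of weight $0$ are regarded as absent). A pair $(x,xy)\in I$ is effective if $\eta(x,xy)=\varepsilon(x)\wedge\rho(xy)$. Cartesian product. For FIGs $X_i=(V_i,E_i,I_i,\varepsilon_i,\rho_i,\eta_i)$, $i=1,2$, the Cartesian product $X_1\times X_2=(V,E,I,\varepsilon,\rho,\eta)$ has $V=V_1\times V_2$; $E=\{(a_1,b_1)(a_2,b_2): a_1=a_2,\ b_1b_2\in E_2\ \text{or}\ a_1a_2\in E_1,\ b_1=b_2\}$; $I$ is the set of pairs $((a_1,b_1),(a_1,b_1)(a_2,b_2))$ such that either $a_1=a_2$ and both $(b_1,b_1b_2),(b_2,b_1b_2)\in I_2$, or $b_1=b_2$ and both $(a_1,a_1a_2),(a_2,a_1a_2)\in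 I_1$; $\varepsilon(a,b)=\varepsilon_1(a)\wedge\varepsilon_2(b)$; $\rho((a_1,b_1)(a_2,b_2))$ equals $\varepsilon_1(a_1)\wedge\rho_2(b_1b_2)$ if $a_1=a_2$, and $\rho_1(a_1a_2)\wedge\varepsilon_2(b_1)$ if $b_1=b_2$; $\eta((a_1,b_1),(a_1,b_1)(a_2,b_2))$ equals $\varepsilon_1(a_1)\wedge\eta_2(b_1,b_1b_2)$ if $a_1=a_2$, and $\eta_1(a_1,a_1a_2)\wedge\varepsilon_2(b_1)$ if $b_1=b_2$. *)

(* Defs.v *)
From HB Require Import structures.
From mathcomp Require Import all_boot all_order all_algebra.
From mathcomp Require Import reals.

Set Implicit Arguments.
Unset Strict Implicit.
Unset Printing Implicit Defensive.

Import Order.TTheory GRing.Theory Num.Theory.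
Local Open Scope ring_scope.

(* Undirected edges and incidence pairs are encoded by ordered pairs of
   vertices: [edge X x y] means xy \in E and [inc X x y] means (x, xy) \in I;
   accordingly [rho X x y] is rho(xy) and [eta X x y] is eta(x, xy). The values
   of [rho] off E and of [eta] off I carry no meaning. *)
Record fig_data (R : realType) (V : finType) := FigData {
  edge : rel V;
  inc : rel V;
  eps : V -> R;
  rho : V -> V -> R;
  eta : V -> V -> R }.

Record is_fig (R : realType) (V : finType) (X : fig_data R V) : Prop := IsFig {
  fig_nonempty : (0 < #|V|)%N;
  fig_edge_sym : symmetric (edge X);
  fig_edge_irr : irreflexive (edge X);
  fig_inc_edge : forall x y, inc X x y -> edge X x y;
  fig_rho_sym : forall x y, edge X x y -> rho X x y = rho X y x;
  fig_eps_itv : forall x, 0 < eps X x <= 1;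
  fig_rho_itv : forall x y, edge X x y -> 0 < rho X x y <= 1;
  fig_eta_itv : forall x y, inc X x y -> 0 < eta X x y <= 1;
  fig_rho_le : forall x y, edge X x y ->
    rho X x y <= Num.min (eps X x) (eps X y);
  fig_eta_le : forall x y, inc X x y ->
    eta X x y <= Num.min (eps X x) (rho X x y) }.

Definition effective_pair (R : realType) (V : finType) (X : fig_data R V)
    (x y : V) : Prop :=
  eta X x y = Num.min (eps X x) (rho X x y).

Definition with_effective_pairs (R : realType) (V : finType)
    (X : fig_data R V) : Prop :=
  forall x y, inc X x y -> effective_pair X x y.

(* The two cases of [rho] and [eta] are exclusive on edges, since a loop-free
   edge relation excludes having both a1 = a2 and b1 = b2. *)
Definition cartesian_product (R : realType) (V1 V2 : finType)
    (X1 : fig_data R V1) (X2 : fig_data R V2) : fig_data R (V1 * V2)%type :=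
  {| edge := fun p q =>
       ((p.1 == q.1) && edge X2 p.2 q.2) || (edge X1 p.1 q.1 && (p.2 == q.2));
     inc := fun p q =>
       [&& p.1 == q.1, inc X2 p.2 q.2 & inc X2 q.2 p.2]
       || [&& p.2 == q.2, inc X1 p.1 q.1 & inc X1 q.1 p.1];
     eps := fun p => Num.min (eps X1 p.1) (eps X2 p.2);
     rho := fun p q =>
       if p.1 == q.1 then Num.min (eps X1 p.1) (rho X2 p.2 q.2)
       else Num.min (rho X1 p.1 q.1) (eps X2 p.2);
     eta := fun p q =>
       if p.1 == q.1 then Num.min (eps X1 p.1) (eta X2 p.2 q.2)
       else Num.min (eta X1 p.1 q.1) (eps X2 p.2) |}.

(* Main.v *)
(* Along an edge of the product one coordinate is constant. In that coordinate
   both terms of a bound carry the same weight, so self-distributivity of the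
   minimum, a /\ (b /\ c) = (a /\ b) /\ (a /\ c), turns each bound, and each
   effectivity equation, of the product into the one of a factor. *)
Require Import Defs.
From HB Require Import structures.
From mathcomp Require Import all_boot all_order all_algebra.
From mathcomp Require Import reals.

Set Implicit Arguments.
Unset Strict Implicit.
Unset Printing Implicit Defensive.

Import Order.TTheory GRing.Theory Num.Theory.
Local Open Scope ring_scope.

Lemma min_itv01 (R : realType) (x y : R) :
  0 < x <= 1 -> 0 < y <= 1 -> 0 < Num.min x y <= 1.
Proof.
by move=> /andP[x0 x1] /andP[y0 _]; rewrite lt_min x0 y0 ge_min x1.
Qed.

(** Interchanging the inner terms on the right brings the two copies of [x] together, and
    idempotence merges them. The common term stands on the left, as when the first coordinate is
    constant. *)
Lemma min_distrr (R : realType) (x y z : R) :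
  Num.min x (Num.min y z) = Num.min (Num.min x y) (Num.min x z).
Proof. by rewrite minACA minxx. Qed.

Lemma min_distrl (R : realType) (x y z : R) :
  Num.min (Num.min x y) z = Num.min (Num.min x z) (Num.min y z).
Proof. by rewrite minACA minxx. Qed.

(** Settles the test [p.1 == q.1] in [rho] and [eta] when an edge moves the first coordinate. *)
Lemma edge_neq (R : realType) (V : finType) (X : fig_data R V) x y :
  is_fig X -> edge X x y -> (x == y) = false.
Proof.
by move=> figX; apply: contraTF => /eqP ->; rewrite (fig_edge_irr figX).
Qed.

Section CartesianProduct.
Variables (R : realType) (V1 V2 : finType).
Variables (X1 : fig_data R V1) (X2 : fig_data R V2).
Hypotheses (figX1 : is_fig X1) (figX2 : is_fig X2).

(** Case analysis on this predicate makes the shared coordinate syntactically equal;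
    [(a == c) = false] selects the [else] branch of [rho]. *)
Variant product_edge_spec : V1 * V2 -> V1 * V2 -> Prop :=
| ProductEdge2 a b d of edge X2 b d : product_edge_spec (a, b) (a, d)
| ProductEdge1 a b c of edge X1 a c & (a == c) = false :
    product_edge_spec (a, b) (c, b).

Lemma product_edgeP p q :
  edge (cartesian_product X1 X2) p q -> product_edge_spec p q.
Proof.
case: p q => [a b] [c d] /= /orP[/andP[/eqP<- e2]|/andP[e1 /eqP<-]].
  exact: ProductEdge2.
by apply: ProductEdge1 => //; apply: edge_neq e1.
Qed.

(** Keeps the incidence directed from the first vertex to the second, whose [eta] enters that of the
    product. *)
Variant product_inc_spec : V1 * V2 -> V1 * V2 -> Prop :=
| ProductInc2 a b d of inc X2 b d : product_inc_spec (a, b) (a, d)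
| ProductInc1 a b c of inc X1 a c & (a == c) = false :
    product_inc_spec (a, b) (c, b).

Lemma product_incP p q :
  inc (cartesian_product X1 X2) p q -> product_inc_spec p q.
Proof.
case: p q => [a b] [c d] /= /orP[/and3P[/eqP<- i2 _]|/and3P[/eqP<- i1 _]].
  exact: ProductInc2.
by apply: ProductInc1 => //; apply: edge_neq (fig_inc_edge figX1 i1).
Qed.

Lemma is_fig_cartesian_product : is_fig (cartesian_product X1 X2).
Proof.
have [ne1 sym1 irr1 ie1 rs1 eps1 rho1 eta1 rle1 ele1] := figX1.
have [ne2 sym2 irr2 ie2 rs2 eps2 rho2 eta2 rle2 ele2] := figX2.
split.
- by rewrite card_prod muln_gt0 ne1.
(* Fixing the left argument of [eq_sym] makes the repeated rewriting stop. *)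
- by move=> p q /=; rewrite sym1 sym2 !(eq_sym q.1, eq_sym q.2).
- by move=> p /=; rewrite irr1 irr2 andbF.
- move=> p q /product_incP[a b d /ie2 e|a b c /ie1 e _] /=.
    by rewrite eqxx e.
  by rewrite e eqxx orbT.
- move=> p q /product_edgeP[a b d /rs2 e|a b c /rs1 e ac] /=.
    by rewrite eqxx e.
  (* The reversed edge tests [c == a], hence the second [ac]. *)
  by rewrite ac eq_sym ac e.
- by move=> p; apply: min_itv01.
- move=> p q /product_edgeP[a b d /rho2 e|a b c /rho1 e ac] /=.
    by rewrite eqxx min_itv01.
  by rewrite ac min_itv01.
- move=> p q /product_incP[a b d /eta2 e|a b c /eta1 e ac] /=.
    by rewrite eqxx min_itv01.
  by rewrite ac min_itv01.
(* Once the common weight is factored out, monotonicity of the minimum leaves the bound of the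
   factor. *)
- move=> p q /product_edgeP[a b d /rle2 e|a b c /rle1 e ac] /=.
    by rewrite eqxx -min_distrr le_min2.
  by rewrite ac -min_distrl le_min2.
- move=> p q /product_incP[a b d /ele2 e|a b c /ele1 e ac] /=.
    by rewrite eqxx -min_distrr le_min2.
  by rewrite ac -min_distrl le_min2.
Qed.

Lemma cartesian_product_effective :
  with_effective_pairs X1 -> with_effective_pairs X2 ->
  with_effective_pairs (cartesian_product X1 X2).
Proof.
move=> eff1 eff2 p q; rewrite /effective_pair.
(* Substituting the factor's value of [eta] leaves exactly a self-distributivity identity. *)
case/product_incP => [a b d /eff2 e|a b c /eff1 e ac] /=.
  by rewrite eqxx e min_distrr.
by rewrite ac e min_distrl.
Qed.

End CartesianProduct.

Theorem proposition4p6 (R : realType) (V1 V2 : finType)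
    (X1 : fig_data R V1) (X2 : fig_data R V2)
    (figX1 : is_fig X1) (figX2 : is_fig X2)
    (effX1 : with_effective_pairs X1) (effX2 : with_effective_pairs X2) :
  is_fig (cartesian_product X1 X2) /\
  with_effective_pairs (cartesian_product X1 X2).
Proof.
split; first exact: is_fig_cartesian_product.
exact: cartesian_product_effective.
Qed.
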